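(* For every positive integer $n$, $$\rho(n)\le \chi_{\mu}\big(S(K_n)\big)\le \chi_{\mu_i}\big(S(K_n)\big)\le \rho(n)+1,$$ where $\rho(n)$ is the smallest number of sets in a $K_4$-free partition of the complete graph $K_n$ and $S(K_n)$ is the subdivision graph of $K_n$.
   Context: All graphs are finite and simple. A geodesic is a shortest path. For a graph $G$ and $X\subseteq V(G)$, two vertices $x,y\in X$ are $X$-visible if there is an $x,y$-geodesic none of whose internal vertices lies in $X$; $X$ is a mutual-visibility (MV) set if every two vertices of $X$ are $X$-visible, and an independent mutual-visibility (IMV) set if moreover $X$ is independent. A map $c:V(G)\to[k]$ is an MV $k$-coloring (resp. IMV $k$-coloring) if every color class $c^{-1}(i)$ is an MV set (resp. IMV set). $\chi_\mu(G)$ (resp. $\chi_{\mu_i}(G)$) is the least $k$ for which $G$ has an MV $k$-coloring (resp. IMV $k$-coloring). The subdivision graph $S(G)$ is obtained from $G$ by replacing every edge $uv$ by a path $u\,e_{uv}\,v$ through a new vertex $e_{uv}$. A graph is $H$-free if it has no subgraph isomorphic to $H$. For $F\subseteq E(G)$, $\langle F\rangle$ denotes the subgraph formed by the edges of $F$ and their endvertices. An $H$-free partition of $G$ is a partition $\{P_1,\dots,P_r\}$ of $E(G)$ such that each $\langle P_i\rangle$ is $H$-free. *)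

(* Defs.v *)
(* asbool (boolp) turns the Prop-valued colorability and partition predicates
   into boolean ones, so that ex_minn can take their least values. *)
From HB Require Import structures.
From mathcomp Require Import all_boot.
From mathcomp Require Import boolp.

Set Implicit Arguments.
Unset Strict Implicit.
Unset Printing Implicit Defensive.

Record sgraph := SGraph {
  vertex :> finType;
  adj : rel vertex;
  adj_sym : symmetric adj;
  adj_irr : irreflexive adj }.

Section Visibility.
Variable G : sgraph.
Implicit Types (x y : G) (p q : seq G) (X : {set G}).

(* The walk is x :: p, of length size p. *)
Definition walk x y p : Prop := path (@adj G) x p /\ last x p = y.

Definition geodesic x y p : Prop :=
  walk x y p /\ forall q, walk x y q -> size p <= size q.

(* The walk x :: p without its two ends. *)
Definition internal x p : seq G := behead (belast x p).

Definition visible X x y : Prop :=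
  exists p, geodesic x y p /\ forall z, z \in internal x p -> z \notin X.

Definition mv_set X : Prop :=
  forall x y, x \in X -> y \in X -> x != y -> visible X x y.

Definition independent X : Prop :=
  forall x y, x \in X -> y \in X -> ~~ adj x y.

Definition imv_set X : Prop := mv_set X /\ independent X.

Definition mv_coloring k (c : G -> 'I_k) : Prop :=
  forall i, mv_set [set v | c v == i].

Definition imv_coloring k (c : G -> 'I_k) : Prop :=
  forall i, imv_set [set v | c v == i].

Definition mv_colorable k : Prop := exists c : G -> 'I_k, mv_coloring c.
Definition imv_colorable k : Prop := exists c : G -> 'I_k, imv_coloring c.

Lemma imv_colorable_card : imv_colorable #|G|.
Proof.
exists enum_rank => i; split=> x y; rewrite !inE => /eqP <- /eqP /enum_rank_inj->.
  by rewrite eqxx.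
by rewrite adj_irr.
Qed.

Lemma ex_imv_colorable : exists k, `[< imv_colorable k >].
Proof. by exists #|G|; apply/asboolP/imv_colorable_card. Qed.

Lemma ex_mv_colorable : exists k, `[< mv_colorable k >].
Proof.
have [c c_imv] := imv_colorable_card; exists #|G|; apply/asboolP.
by exists c => i; have [] := c_imv i.
Qed.

Definition chi_mu : nat := ex_minn ex_mv_colorable.
Definition chi_mui : nat := ex_minn ex_imv_colorable.

End Visibility.

Definition edges (G : sgraph) : {set {set G}} :=
  [set [set x; y] | x in G, y in G & adj x y].

Section Subdivision.
Variable G : sgraph.

Definition subdiv_vertex : finType := (G + {e : {set G} | e \in edges G})%type.

Definition subdiv_adj : rel subdiv_vertex := fun a b =>
  match a, b with
  | inl u, inr e => u \in val e
  | inr e, inl u => u \in val e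
  | _, _ => false
  end.

Lemma subdiv_adj_sym : symmetric subdiv_adj.
Proof. by case=> [u|e] [v|f]. Qed.

Lemma subdiv_adj_irr : irreflexive subdiv_adj.
Proof. by case. Qed.

Definition subdivision : sgraph := SGraph subdiv_adj_sym subdiv_adj_irr.

End Subdivision.

Section EdgeSubgraph.
Variables (V : finType) (F : {set {set V}}).

Definition edge_subgraph_vertex : finType := {x : V | x \in cover F}.

(* If F consists of edges of a simple graph, x != y is automatic; it only
   makes the relation irreflexive for an arbitrary F. *)
Definition edge_subgraph_adj : rel edge_subgraph_vertex := fun x y =>
  (x != y) && ([set val x; val y] \in F).

Lemma edge_subgraph_adj_sym : symmetric edge_subgraph_adj.
Proof. by move=> x y; rewrite /edge_subgraph_adj eq_sym setUC. Qed.

Lemma edge_subgraph_adj_irr : irreflexive edge_subgraph_adj.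
Proof. by move=> x; rewrite /edge_subgraph_adj eqxx. Qed.

Definition edge_subgraph : sgraph :=
  SGraph edge_subgraph_adj_sym edge_subgraph_adj_irr.

End EdgeSubgraph.

(* Subgraphs need not be induced: f is injective and preserves adjacency. *)
Definition has_copy (H G : sgraph) : Prop :=
  exists f : H -> G, injective f /\ forall x y, adj x y -> adj (f x) (f y).

Definition Hfree (H G : sgraph) : Prop := ~ has_copy H G.

Definition Hfree_partition (H G : sgraph) (P : {set {set {set G}}}) : Prop :=
  partition P (edges G) /\ forall F, F \in P -> Hfree H (edge_subgraph F).

Definition complete_adj (n : nat) : rel 'I_n := fun x y => x != y.

Lemma complete_adj_sym n : symmetric (@complete_adj n).
Proof. by move=> x y; rewrite /complete_adj eq_sym. Qed.

Lemma complete_adj_irr n : irreflexive (@complete_adj n).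
Proof. by move=> x; rewrite /complete_adj eqxx. Qed.

Definition complete (n : nat) : sgraph :=
  SGraph (@complete_adj_sym n) (@complete_adj_irr n).

Definition K4free_partitionable (n k : nat) : Prop :=
  exists P : {set {set {set complete n}}},
    Hfree_partition (complete 4) P /\ #|P| = k.

Lemma ex_K4free_partitionable n : exists k, `[< K4free_partitionable n k >].
Proof.
pose E := edges (complete n); pose P := [set [set e] | e in E].
exists #|P|; apply/asboolP; exists P; split=> //; split.
  apply/and3P; split.
  - rewrite cover_imset; apply/eqP/setP=> e.
    by apply/bigcupP/idP=> [[f fE /set1P->//]|eE]; exists e; rewrite ?set11.
  - apply/trivIsetP=> _ _ /imsetP[e _ ->] /imsetP[f _ ->] ne.
    by rewrite disjoints1 inE; apply: contra ne => /eqP->.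
  - by apply/imsetP=> -[e _ /setP/(_ e)]; rewrite !inE eqxx.
move=> _ /imsetP[e /imset2P[x y _ _ ->] ->] [f [f_inj _]].
have : #|[set val (f i) | i : complete 4]| <= #|[set x; y]|.
  apply/subset_leq_card/subsetP => _ /imsetP[i _ ->].
  move: (f i) => v; move: (valP v); move: (val v) => w; rewrite /cover big_set1.
  exact.
rewrite card_imset => [|i j /val_inj/f_inj//].
by rewrite card_ord cards2; case: (x != y).
Qed.

Definition rho (n : nat) : nat := ex_minn (ex_K4free_partitionable n).

(* Main.v *)
(* Two disjoint edges e, f of K_n are at distance 4 in S(K_n), and the interior
   of an e,f-geodesic is x, xy, y with x in e and y in f.  Hence a set of edges
   is mutual-visibility in S(K_n) as soon as no two disjoint members of it have
   all four connecting edges in it, i.e. as soon as it contains no K_4, and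
   this is also necessary.  The original vertices form one further IMV class. *)
Require Import Defs.
From mathcomp Require Import all_boot.
From mathcomp Require Import boolp.

Set Implicit Arguments.
Unset Strict Implicit.
Unset Printing Implicit Defensive.

(** Distinct nonadjacent vertices are at distance at least 2, so the walk through [w] is a geodesic.
    In S(K_n) this settles two original vertices, and two edges with a common endpoint. *)
Lemma visible_common_neighbour (G : sgraph) (X : {set G}) (x w y : G) :
  adj x w -> adj w y -> x != y -> ~~ adj x y -> w \notin X -> visible X x y.
Proof.
move=> xw wy xNy xyN wX; exists [:: w; y]; split; last by move=> z /[1!inE] /eqP->.
split; first by rewrite /walk /= xw wy.
case=> [|a [|b q]] //= [].
- by move=> _ /= xy; rewrite xy eqxx in xNy.
- by move=> /= /[1!andbT] xa ay; rewrite -ay xa in xyN.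
Qed.

Lemma mv_coloring_imv (G : sgraph) k : imv_colorable G k -> mv_colorable G k.
Proof. by move=> [c c_imv]; exists c => i; have [] := c_imv i. Qed.

(** Lets the upper bound use an option type of colors, with [None] as the extra color. *)
Lemma imv_colorable_fin (G : sgraph) (T : finType) (g : G -> T) :
  (forall t, imv_set [set v | g v == t]) -> imv_colorable G #|T|.
Proof.
move=> g_imv; exists (enum_rank \o g) => i.
suff -> : [set v | (enum_rank \o g) v == i] = [set v | g v == enum_val i] by [].
by apply/setP=> v; rewrite !inE /= -(inj_eq enum_val_inj) enum_rankK.
Qed.

Lemma edge_subgraph_copyP (V : finType) (F : {set {set V}}) m :
  has_copy (complete m.+2) (edge_subgraph F) <->
  exists v : 'I_m.+2 -> V,
    injective v /\ forall i j, i != j -> [set v i; v j] \in F.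
Proof.
split=> [[f [f_inj f_adj]]|[v [v_inj vF]]].
  exists (val \o f); split=> [i j /val_inj/f_inj//|i j ij].
  by have /andP[] := f_adj i j ij.
(* The vertices of [edge_subgraph F] must be covered by [F]; since there are at least two indices,
   each [v i] is an end of an edge of [F]. *)
have v_cover i : v i \in cover F.
  have [j ij] : exists j, i != j.
    by exists (if i == ord0 then ord_max else ord0); case: ifP => [/eqP->|->].
  by apply/bigcupP; exists [set v i; v j]; rewrite ?vF ?set21.
exists (fun i => exist (fun x => x \in cover F) (v i) (v_cover i)).
split=> [i j [/v_inj//]|i j ij].
by apply/andP; split; [apply: contraNneq ij => -[/v_inj->]|exact: vF].
Qed.

(** Walks in S(G) alternate between original vertices and edges, so the length is 0, 2 or 4. Length
    0 would force e = f and length 2 a common endpoint. *)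
Lemma walk_disjoint_edges (G : sgraph)
    (e f : {e : {set G} | e \in edges G}) (p : seq (subdivision G)) :
  [disjoint val e & val f] ->
  @walk (subdivision G) (inr e) (inr f) p -> size p <= 4 ->
  exists x g y, p = [:: inl x; inr g; inl y; inr f] /\
    [/\ x \in val e, x \in val g, y \in val g & y \in val f].
Proof.
move=> /pred0P ef [].
have noI x : x \in val e -> x \in val f -> False.
  by move=> xe xf; have := ef x; rewrite /= xe xf.
have [x xe] : exists x, x \in val e.
  by case: e {ef noI} => ? /=/[dup] /imset2P[x y _ _ ->] _; exists x; rewrite set21.
case: p => [|[a|?] [|[?|g] [|[b|?] [|[?|h] [|? p]]]]] //=; rewrite ?andbF ?andbT //.
- by move=> _ [efE]; case: (noI x) => //; rewrite -efE.
- by move=> /andP[ae ag] [gf]; case: (noI a) => //; rewrite -gf.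
- move=> /and4P[ae ag bg bh] [hf] _; exists a, g, b; rewrite -hf.
  by split; [|split].
Qed.

Lemma visible_disjoint_edges (G : sgraph) (X : {set subdivision G})
    (e f g : {e : {set G} | e \in edges G}) (x y : G) :
  [disjoint val e & val f] ->
  x \in val e -> x \in val g -> y \in val g -> y \in val f ->
  inl x \notin X -> inl y \notin X -> inr g \notin X ->
  visible X (inr e) (inr f).
Proof.
move=> ef xe xg yg yf xX yX gX; exists [:: inl x; inr g; inl y; inr f].
split; last by move=> z; rewrite !inE => /or3P[] /eqP->.
split; first by rewrite /walk /= xe xg yg yf.
(* A competing walk of length at most 4 has length exactly 4. *)
move=> q /(walk_disjoint_edges ef); case: (leqP (size q) 4) => [_|/ltnW//].
by case=> // ? [? [? [-> _]]].
Qed.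

Lemma mem_edges_complete n (u v : complete n) :
  ([set u; v] \in edges (complete n)) = (u != v).
Proof.
apply/idP/idP=> [/imset2P[a b _ /[1!inE] ab uv]|uv]; last first.
  by apply/imset2P; exists u v; rewrite ?inE.
have : #|[set u; v]| = 2 by rewrite uv cards2 (ab : a != b).
by rewrite cards2; case: (u != v).
Qed.

Lemma edges_completeP n (e : {set complete n}) :
  e \in edges (complete n) -> exists a b, a != b /\ e = [set a; b].
Proof. by move=> /imset2P[a b _ /[1!inE] ab ->]; exists a, b. Qed.

(** In a K_4 on v0, v1, v2, v3 inside one color class, the edges v0v1 and v2v3 could not see each
    other: every geodesic between them has one of the four connecting edges in its middle. *)
Lemma mv_coloring_class_K4free n k (c : subdivision (complete n) -> 'I_k)
    (i : 'I_k) (F : {set {set complete n}}) :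
  mv_coloring c ->
  (forall e, e \in F ->
     exists s : {e | e \in edges (complete n)}, val s = e /\ c (inr s) = i) ->
  Hfree (complete 4) (edge_subgraph F).
Proof.
move=> c_mv FE /edge_subgraph_copyP[v [v_inj vF]].
pose o j : 'I_4 := inord j.
have oE j l : j < 4 -> l < 4 -> (v (o j) == v (o l)) = (j == l).
  by move=> j4 l4; rewrite (inj_eq v_inj) -val_eqE /= !inordK.
have oN j l : j < 4 -> l < 4 -> j != l -> o j != o l.
  by move=> j4 l4; rewrite -val_eqE /= !inordK.
have [e [eE ce]] := FE _ (vF (o 0) (o 1) (oN 0 1 isT isT isT)).
have [f [fE cf]] := FE _ (vF (o 2) (o 3) (oN 2 3 isT isT isT)).
have ef : [disjoint val e & val f].
  apply/pred0P=> x /=; rewrite eE fE !inE; apply/negP.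
  by case/andP=> /orP[] /eqP->; rewrite !oE.
have [|||p [[p_walk p_min] pX]] := c_mv i (inr e) (inr f).
- by rewrite inE ce.
- by rewrite inE cf.
- by apply/eqP=> -[efE]; have := pred0P ef (v (o 0)); rewrite -efE /= eE set21.
have cross j l : j \in [:: 0; 1] -> l \in [:: 2; 3] ->
    exists g : {e | e \in edges (complete n)},
      val g = [set v (o j); v (o l)] /\ c (inr g) = i.
  by rewrite !inE => /orP[] /eqP-> /orP[] /eqP->; apply/FE/vF/oN.
(* The walk through the connecting edge v0v2 bounds the length of the geodesic. *)
have p4 : size p <= 4.
  have [g [gE _]] := cross 0 2 isT isT.
  apply: (p_min [:: inl (v (o 0)); inr g; inl (v (o 2)); inr f]).
  by split=> //=; rewrite gE eE fE !inE !eqxx !orbT.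
have [x [g [y [pE [xe xg yg yf]]]]] := walk_disjoint_edges ef p_walk p4.
have := pX (inr g); rewrite pE !inE eqxx orbT /= => /(_ isT) /negP[].
have [h [hE <-]] : exists h : {e | e \in edges (complete n)},
    val h = [set x; y] /\ c (inr h) = i.
  move: xe yf; rewrite eE fE !inE.
  by case/orP=> /eqP-> /orP[] /eqP->; apply: cross.
(* The middle edge [g] has two elements and contains the distinct vertices [x] and [y], so it is the
   connecting edge [h] of color [i]. *)
suff -> : g = h by [].
apply/val_inj; rewrite hE.
have xy : x != y.
  by apply: contraTneq xe => ->; rewrite (disjointFl ef).
have [a [b [ab gE]]] := edges_completeP (valP g).
apply/esym/eqP; rewrite eqEcard subUset !sub1set xg yg.
by rewrite gE !cards2 ab xy.
Qed.

Lemma rho_le_chi_mu n : rho n <= chi_mu (subdivision (complete n)).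
Proof.
rewrite /chi_mu; case: ex_minnP => k /asboolP[c c_mv] _.
pose E := edges (complete n).
(* [preim_partition] needs a function on all vertex sets; those that are not edges get [None]. *)
pose col (e : {set complete n}) : option 'I_k :=
  omap (fun s : {e | e \in E} => c (inr s)) (insub e).
have colE (s : {e | e \in E}) : col (val s) = Some (c (inr s)).
  by rewrite /col valK.
pose P := preim_partition col E.
have PE F : F \in P -> exists i, F = [set e in E | col e == Some i].
  move=> /imsetP[e eE ->]; exists (c (inr (exist _ e eE))).
  by apply/setP=> f; rewrite !inE (colE (exist _ e eE) : col e = _) eq_sym.
(* Each block is the edge part of a color class; colors that no edge receives yield no block, hence
   only an inequality. *)
have Pk : #|P| <= k.
  rewrite -[k in _ <= k]card_ord.
  apply: leq_trans (leq_imset_card (fun i => [set e in E | col e == Some i]) _).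
  by apply/subset_leq_card/subsetP=> F /PE[i ->]; apply: imset_f.
apply: leq_trans Pk; rewrite /rho; case: ex_minnP => r _; apply.
apply/asboolP; exists P; split=> //; split; first exact: preim_partitionP.
move=> _ /PE[i ->]; apply: (mv_coloring_class_K4free (i := i) c_mv) => e.
rewrite inE => /andP[eE]; rewrite (colE (exist _ e eE) : col e = _) => /eqP[ci].
by exists (exist _ e eE).
Qed.

Lemma K4free_cross_edge n (F : {set {set complete n}}) (a b c d : complete n) :
  Hfree (complete 4) (edge_subgraph F) -> uniq [:: a; b; c; d] ->
  [set a; b] \in F -> [set c; d] \in F ->
  exists x y, [/\ x \in [set a; b], y \in [set c; d] & [set x; y] \notin F].
Proof.
move=> Ffree abcd abF cdF; apply: contrapT => noxy; apply: Ffree.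
have cross x y : x \in [set a; b] -> y \in [set c; d] -> [set x; y] \in F.
  by move=> xab ycd; apply: contrapT => /negP xyF; apply: noxy; exists x, y.
apply/edge_subgraph_copyP; exists (tnth [tuple a; b; c; d]); split.
  by apply/tuple_uniqP.
(* Edges are unordered, so six index pairs remain: [abF], [cdF] and four instances of [cross]. *)
move=> i j; wlog ij : i j / i < j => [H ijN|_].
  have [ij|ji|/val_inj ijE] := ltngtP i j; first exact: H.
    by rewrite setUC; apply: H; rewrite // eq_sym.
  by rewrite ijE eqxx in ijN.
case: i j ij => [[|[|[|[|?]]]] ?] [[|[|[|[|?]]]] ?] //= _;
  rewrite !(tnth_nth a) //=;
  by apply: cross; rewrite ?set21 ?set22.
Qed.

Lemma imv_colorable_of_partition n (P : {set {set {set complete n}}}) :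
  Hfree_partition (complete 4) P -> imv_colorable (subdivision (complete n)) #|P|.+1.
Proof.
move=> [P_part P_free].
have <- : #|{: option {F | F \in P}}| = #|P|.+1 by rewrite card_option card_sig.
(* An edge is colored by its block. As [P] covers all edges, [insub] never fails on one, so the
   class of [None] consists of the original vertices alone. *)
pose g (v : subdivision (complete n)) : option {F | F \in P} :=
  if v is inr e then insub (pblock P (val e)) else None.
have [/eqP coverP triv _] := and3P P_part.
have gr (e : {e | e \in edges (complete n)}) (F : {F | F \in P}) :
    (g (inr e) == Some F) = (val e \in val F).
  have eP : pblock P (val e) \in P by rewrite pblock_mem // coverP (valP e).
  rewrite /g insubT; apply/eqP/idP=> [[<-]|eF].
    by rewrite /= mem_pblock coverP (valP e).
  by congr Some; apply: val_inj; apply: def_pblock eF => //; apply: valP.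
have grN e : g (inr e) != None.
  by rewrite /g insubT // pblock_mem // coverP (valP e).
apply: (imv_colorable_fin (g := g)) => -[F|]; last first.
  split=> [] [u|e] [v|f]; rewrite !inE ?(negPf (grN _)) // => _ _ uv.
  have uv' : u != v by [].
  have uvE : [set u; v] \in edges (complete n) by rewrite mem_edges_complete.
  (* In a complete graph any two original vertices have their own edge as common neighbor, and it
     lies outside their class. *)
  pose uvs : {e | e \in edges (complete n)} := exist _ [set u; v] uvE.
  apply: (@visible_common_neighbour (subdivision (complete n)) _
    (inl u) (inr uvs) (inl v)) => //=.
  - by rewrite set21.
  - by rewrite set22.
  - by rewrite inE grN.
split=> [] [u|e] [v|f]; rewrite !inE ?gr // => eF fF ef.
have lX x : inl x \notin [set v | g v == Some F] by rewrite inE.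
(* Edges that meet see each other through a shared endpoint. Disjoint ones use a connecting edge
   outside the block, which exists because the block is K_4-free. *)
have [ef0|/pred0Pn[x /andP[xe xf]]] := boolP [disjoint val e & val f]; last first.
  by apply: (@visible_common_neighbour (subdivision (complete n)) _
    (inr e) (inl x) (inr f)).
have [a [b [ab eE]]] := edges_completeP (valP e).
have [c [d [cd fE]]] := edges_completeP (valP f).
have abcd : uniq [:: a; b; c; d].
  have := disjointFr ef0; rewrite eE fE => ef0'.
  have := ef0' a (set21 _ _); have := ef0' b (set22 _ _).
  by rewrite /= !inE negb_or ab cd => -> ->.
have [||x [y [xab ycd xyF]]] := K4free_cross_edge (P_free _ (valP F)) abcd.
- by rewrite -eE.
- by rewrite -fE.
have xy : x != y.
  by apply: contraTneq xab => ->; rewrite -eE (disjointFl ef0) ?fE.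
have xyE : [set x; y] \in edges (complete n) by rewrite mem_edges_complete.
pose xys : {e | e \in edges (complete n)} := exist _ [set x; y] xyE.
apply: (@visible_disjoint_edges _ _ e f xys x y) => //=.
- by rewrite eE.
- exact: set21.
- exact: set22.
- by rewrite fE.
- by rewrite inE gr.
Qed.

Theorem theorem2p1 (n : nat) (hn : 0 < n) :
  [/\ rho n <= chi_mu (subdivision (complete n)),
      chi_mu (subdivision (complete n)) <= chi_mui (subdivision (complete n))
    & chi_mui (subdivision (complete n)) <= (rho n).+1].
Proof.
split; first exact: rho_le_chi_mu.
  rewrite /chi_mui; case: ex_minnP => k /asboolP/mv_coloring_imv k_mv _.
  by rewrite /chi_mu; case: ex_minnP => m _; apply; apply/asboolP.
rewrite /rho; case: ex_minnP => _ /asboolP[P [P_free <-]] _.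
rewrite /chi_mui; case: ex_minnP => m _; apply; apply/asboolP.
exact: imv_colorable_of_partition.
Qed.
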